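(* Let $p\in[1,\infty)$, let $\mu,\nu\in P_p(\mathbb{R})$ be two probability measures on $\mathbb{R}$ with finite moment of order $p$, and let $F$ and $G$ be the distribution functions of $\mu$ and $\nu$, respectively. Then $$(W_p(\mu,\nu))^p=\int_{\mathbb{R}}\int_{\mathbb{R}}|x-y|^p\,dM(F(x),G(y)),$$ where $M(u,v)=\min(u,v)$ is the two-dimensional comonotonicity copula.
   Context: The distribution function of a probability measure $\mu$ on $\mathbb{R}$ is $F(x)=\mu((-\infty,x])$ (right-continuous). $P_p(\mathbb{R})$ is the set of Borel probability measures $\mu$ on $\mathbb{R}$ with $\int_{\mathbb{R}}|x|^p\,\mu(dx)<\infty$. A coupling of $\mu$ and $\nu$ is a Borel probability measure $\pi$ on $\mathbb{R}\times\mathbb{R}$ with $\pi(A\times\mathbb{R})=\mu(A)$ and $\pi(\mathbb{R}\times A)=\nu(A)$ for all Borel $A\subseteq\mathbb{R}$; $\Pi(\mu,\nu)$ denotes the set of all couplings. The $p$-Wasserstein distance on $\mathbb{R}$ is defined by $$(W_p(\mu,\nu))^p=\inf_{\pi\in\Pi(\mu,\nu)}\int_{\mathbb{R}\times\mathbb{R}}|x-y|^p\,\pi(dx,dy).$$ The comonotonicity copula is $M:[0,1]^2\to[0,1]$, $M(u,v)=\min(u,v)$. The function $(x,y)\mapsto M(F(x),G(y))$ is a joint distribution function on $\mathbb{R}^2$ with margins $F$ and $G$, and $\int_{\mathbb{R}}\int_{\mathbb{R}}g(x,y)\,dM(F(x),G(y))$ denotes the integral of $g$ with respect to the probability measure on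 $\mathbb{R}^2$ having this distribution function. *)

(* Defs.v *)
From HB Require Import structures.
From mathcomp Require Import all_boot all_order all_algebra.
From mathcomp Require Import all_classical all_reals all_analysis.

Set Implicit Arguments.
Unset Strict Implicit.
Unset Printing Implicit Defensive.

Import Order.TTheory GRing.Theory Num.Theory.
Import numFieldNormedType.Exports.

Local Open Scope classical_set_scope.
Local Open Scope ring_scope.
Local Open Scope ereal_scope.

Notation borel_prob R := (probability (measurableTypeR R) R).
Notation borel_prob2 R :=
  (probability (prod (measurableTypeR R) (measurableTypeR R)) R).

Definition distribution_function (R : realType) (mu : borel_prob R) (x : R) :
  R := fine (mu `]-oo, x]%classic).

Definition finite_moment (R : realType) (p : R) : set (borel_prob R) :=
  [set mu : borel_prob R | \int[mu]_x ((`|x : R| `^ p)%R)%:E < +oo].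

Definition coupling (R : realType) (mu nu : borel_prob R) : set (borel_prob2 R) :=
  [set pi : borel_prob2 R | forall A : set (measurableTypeR R), measurable A ->
     pi (A `*` setT) = mu A /\ pi (setT `*` A) = nu A].

Definition wasserstein (R : realType) (p : R) (mu nu : borel_prob R) : \bar R :=
  ereal_inf [set \int[pi]_z ((`|(z.1 : R) - (z.2 : R)| `^ p)%R)%:E
            | pi in coupling mu nu] `^ p^-1.

Definition comonotonicity_copula (R : realType) (u v : R) : R := Num.min u v.

Definition has_joint_df (R : realType) (H : R -> R -> R) : set (borel_prob2 R) :=
  [set pi : borel_prob2 R | forall x y : R,
    pi (`]-oo, x]%classic `*` `]-oo, y]%classic) = (H x y)%:E].

(* The probability measure dH on R^2 whose joint distribution function is H.
   Such a measure is unique; [get] returns a junk value when there is none,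
   i.e. when H is not a joint distribution function. *)
Definition joint_law (R : realType) (H : R -> R -> R) : borel_prob2 R :=
  get (has_joint_df H).

(* Main.v *)
(* Every coupling p of mu and nu satisfies
   p (]-oo, x] x ]-oo, y]) <= min(F x, G y), with equality for the comonotone
   law, which exists as the image of the uniform law on ]0, 1[ under the pair of
   quantile functions.  Hence the comonotone law gives the least mass to all the
   sets {x <= s, t < y} and {y <= s, t < x}.  The cost |x - y|^p is a positive
   mixture of indicators of such sets with s <= t: the truncated distance
   (|x - y| - k)_+ integrates them over s with t = s + k, and for p > 1,
   |x - y|^p is the integral of p (|x - y| - r^(1/(p-1)))_+ over r >= 0.
   By Tonelli the comonotone law minimizes the cost. *)

Require Import Defs.
From HB Require Import structures.
From mathcomp Require Import all_boot all_order all_algebra.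
From mathcomp Require Import all_classical all_reals all_analysis.
From mathcomp Require Import measurable_realfun.
From mathcomp Require Import lra.

Set Implicit Arguments.
Unset Strict Implicit.
Unset Printing Implicit Defensive.

Import Order.TTheory GRing.Theory Num.Theory.
Import numFieldNormedType.Exports.

Local Open Scope classical_set_scope.
Local Open Scope ring_scope.
Local Open Scope ereal_scope.

(** * Borel probabilities are determined by their masses on rays *)

Section ray_determination.
Context {R : realType}.
Implicit Types P Q : borel_prob R.

(** The open right rays generate the Borel sets, are stable under intersection and exhaust the line
    along [g]; their masses are the complements of those of the closed left rays, so uniqueness of
    measures on a pi-system applies. *)
Lemma borel_prob_eq_rays P Q :
  (forall x : R, P `]-oo, x]%classic = Q `]-oo, x]%classic) ->
  forall A : set (measurableTypeR R), measurable A -> P A = Q A.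
Proof.
move=> PQ A mA.
pose g (n : nat) : set R := `](- n%:R)%R, +oo[%classic.
refine (@measure_unique _ R (measurableTypeR R) (@RGenOInfty.G R) g
  _ _ _ _ P Q _ _ A mA) => //.
- exact: RGenOInfty.measurableE.
- move=> _ _ [x ->] [y ->]; exists (Num.max x y).
  by apply/seteqP; split=> z /=; rewrite !in_itv/= !andbT gt_max => /andP.
- by move=> n; exists (- n%:R)%R.
- rewrite -subTset => x _; exists (Num.bound x) => //=.
  by rewrite /g/= in_itv/= andbT ltrNl unstable.ltrNbound.
- move=> _ [x ->].
  have rayC (S : borel_prob R) : S `]x, +oo[%classic = 1 - S `]-oo, x]%classic.
    by rewrite -setCitvl; apply: probability_setC; exact: measurable_itv.
  exact: eq_trans (rayC P) (eq_trans (congr1 (fun z => 1 - z) (PQ x)) (esym (rayC Q))).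
- by move=> n; rewrite (le_lt_trans (probability_le1 _ _)) ?ltry//; exact: measurable_itv.
Qed.

End ray_determination.

(** * Distribution functions and quantile functions *)

Section distribution_functions.
Context {R : realType}.
Variable mu : borel_prob R.
Local Notation F := (distribution_function mu).

(** Seen as a random variable under [mu], the identity has [F] as its [cdf], whose monotonicity,
    limits and right-continuity thus carry over. *)
Let idTR : measurableTypeR R -> R := idfun.

#[local] HB.instance Definition _ :=
  @isMeasurableFun.Build _ _ _ _ idTR (@measurable_id _ _ setT).

Lemma distribution_functionE (x : R) : (F x)%:E = mu `]-oo, x]%classic.
Proof. by rewrite fineK// fin_num_measure//; exact: measurable_itv. Qed.

Lemma distribution_function_cdf (x : R) : (F x)%:E = cdf (idTR : {RV mu >-> R}) x.
Proof. exact: distribution_functionE. Qed.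

Lemma distribution_function_ge0 (x : R) : (0 <= F x)%R.
Proof. by rewrite -lee_fin distribution_functionE. Qed.

Lemma distribution_function_le1 (x : R) : (F x <= 1)%R.
Proof. by rewrite -lee_fin distribution_function_cdf cdf_le1. Qed.

Lemma distribution_function_nd : {homo F : x y / (x <= y)%R}.
Proof.
by move=> x y xy; rewrite -lee_fin !distribution_function_cdf cdf_nondecreasing.
Qed.

Lemma distribution_function_cvgy : F x @[x --> +oo%R] --> (1:R)%R.
Proof. by apply: fine_cvg; exact: (cvg_cdfy1 (idTR : {RV mu >-> R})). Qed.

Lemma distribution_function_cvgNy : F x @[x --> -oo%R] --> (0:R)%R.
Proof. by apply: fine_cvg; exact: (cvg_cdfNy0 (idTR : {RV mu >-> R})). Qed.

Lemma distribution_function_right_continuous (a : R) : F x @[x --> a^'+] --> F a.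
Proof.
apply: fine_cvg; rewrite distribution_function_cdf.
exact: (@cdf_right_continuous _ _ _ _ (idTR : {RV mu >-> R})).
Qed.

Definition quantile (u : R) : R := inf [set x | (u <= F x)%R].

(** This is the Galois connection between quantile and distribution function. The limits of [F] at
    both infinities make the defining set nonempty and bounded below when u lies strictly between 0
    and 1; right-continuity makes its infimum attained. *)
Lemma quantile_le (u x : R) : (0 < u < 1)%R ->
  (quantile u <= x)%R = (u <= F x)%R.
Proof.
move=> /andP[u0 u1].
have S0 : [set y | (u <= F y)%R] !=set0.
  have : \forall y \near +oo%R, (u < F y)%R.
    exact: (cvgr_gt _ distribution_function_cvgy).
  by move=> /filter_ex -[y /ltW]; exists y.
have lbS : has_lbound [set y | (u <= F y)%R].
  have : \forall y \near -oo%R, (F y < u)%R.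
    exact: (cvgr_lt _ distribution_function_cvgNy).
  move=> /filter_ex -[y Fyu]; exists y => z /= uFz.
  rewrite leNgt; apply/negP => /ltW /distribution_function_nd.
  by move=> /(le_trans uFz); rewrite leNgt Fyu.
apply/idP/idP => [Qx|uFx]; last exact: ge_inf.
rewrite leNgt; apply/negP => Fxu.
(* If F x < u, right-continuity gives some y > x with F y < u still. By monotonicity this y is a
   lower bound of the defining set, so that y <= [quantile u] <= x, a contradiction. *)
have : \forall y \near x^'+, (F y < u)%R /\ (x < y)%R.
  near=> y; split; near: y; last exact: nbhs_right_gt.
  exact: (cvgr_lt _ (distribution_function_right_continuous (a := x))).
move=> /(@filter_ex _ _ (at_right_proper_filter x)) -[y [Fyu xy]].
suff : (y <= quantile u)%R by move=> /le_trans /(_ Qx); rewrite leNgt xy.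
apply: lb_le_inf => // z /= uFz; rewrite leNgt; apply/negP => /ltW.
by move=> /distribution_function_nd /(le_trans uFz); rewrite leNgt Fyu.
Unshelve. all: by end_near. Qed.

(* Truncated to 0 outside ]0, 1[, where [quantile] takes junk values. *)
Lemma measurable_quantile :
  measurable_fun [set: measurableTypeR R] (quantile \_ `]0%R, 1%R[).
Proof.
apply: (measurable_restrictT _ (measurable_itv _)).1.
apply: (measurability _ (RGenOInfty.measurableE R)).
move=> _ [_ [x ->] <-].
rewrite (_ : _ `&` _ = `]0%R, 1%R[ `&` `]F x, +oo[); first exact: measurableI.
apply/seteqP; split=> u /= []; rewrite !in_itv/= !andbT => u01 Fxu; split => //.
  by move: Fxu; rewrite !ltNge quantile_le.
by rewrite ltNge quantile_le// -ltNge.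
Qed.

End distribution_functions.

(** * The comonotone law as an image of the uniform law *)

Section comonotone_law.
Context {R : realType}.

(** The interval is open because at level 0 the set defining a quantile is unbounded below, and at
    level 1 it may be empty. *)
Definition uniform_oo : set (measurableTypeR R) -> \bar R :=
  mrestr lebesgue_measure (measurable_itv (`]0%R, 1%R[ : interval R)).

HB.instance Definition _ := Measure.on uniform_oo.

Let uniform_ooT : uniform_oo [set: _] = 1.
Proof.
rewrite /uniform_oo /mrestr setTI lebesgue_measure_itv/=.
by rewrite lte_fin ltr01 sube0.
Qed.

HB.instance Definition _ :=
  Measure_isProbability.Build _ _ _ uniform_oo uniform_ooT.

(** Only the trace of [A] on ]0, 1[ counts: it is ]0, m] if m < 1, possibly empty, and all of ]0, 1[
    if m = 1. Preimages of rays and quadrants under quantiles have this form. *)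
Lemma uniform_oo_ray (A : set (measurableTypeR R)) (m : R) : (0 <= m <= 1)%R ->
  (forall u : R, (0 < u < 1)%R -> A u <-> (u <= m)%R) -> uniform_oo A = m%:E.
Proof.
move=> /andP[m0 m1] Am; rewrite /uniform_oo /mrestr.
have [mlt|mge] := ltP m 1%R.
  rewrite (_ : _ `&` _ = `]0%R, m]%classic); last first.
    apply/seteqP; split=> u /=; rewrite !in_itv/=.
      by move=> -[Au /[dup] u01 /andP[-> _]]; apply/Am.
    move=> /andP[u0 um]; have u01 : (0 < u < 1)%R.
      by rewrite u0 (le_lt_trans um).
    by split=> //; apply/Am.
  rewrite lebesgue_measure_itv/= lte_fin; case: ltP => [_|m0']; first by rewrite sube0.
  by congr EFin; apply/eqP; rewrite eq_le m0 m0'.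
have -> : m = 1%R by apply/eqP; rewrite eq_le m1 mge.
rewrite (_ : _ `&` _ = `]0%R, 1%R[%classic).
  by rewrite lebesgue_measure_itv/= lte_fin ltr01 sube0.
apply/seteqP; split=> u /=; rewrite !in_itv/=; first by case.
move=> u01.
split=> //; apply/Am => //; rewrite (le_trans _ mge)//.
by case/andP : u01 => _ /ltW.
Qed.

Variables mu nu : borel_prob R.
Local Notation F := (distribution_function mu).
Local Notation G := (distribution_function nu).

(** The same level [u] feeds both quantiles, which makes the image law comonotone. *)
Let quantile_pair (u : measurableTypeR R) : measurableTypeR R * measurableTypeR R :=
  ((quantile mu \_ `]0%R, 1%R[) u, (quantile nu \_ `]0%R, 1%R[) u).

Let measurable_quantile_pair : measurable_fun setT quantile_pair.
Proof. by apply: measurable_fun_pair; exact: measurable_quantile. Qed.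

HB.instance Definition _ :=
  isMeasurableFun.Build _ _ _ _ quantile_pair measurable_quantile_pair.

Definition comonotone_law : borel_prob2 R := distribution uniform_oo quantile_pair.

Let quantile_patch_le (la : borel_prob R) (u x : R) : (0 < u < 1)%R ->
  ((quantile la \_ `]0%R, 1%R[) u <= x)%R = (u <= distribution_function la x)%R.
Proof.
by move=> u01; rewrite patchE mem_set/= ?in_itv//=; exact: quantile_le.
Qed.

(** By the Galois connection, the two quantiles at level u are at most x and y exactly when u <= F x
    and u <= G y, that is, when u <= min(F x, G y). *)
Lemma comonotone_law_joint_df :
  has_joint_df (fun x y => comonotonicity_copula (F x) (G y)) comonotone_law.
Proof.
move=> x y; apply: uniform_oo_ray => [|u u01].
  rewrite /comonotonicity_copula le_min ge_min !distribution_function_ge0.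
  by rewrite distribution_function_le1.
rewrite /comonotonicity_copula le_min -!quantile_patch_le//.
by split=> /=; rewrite !in_itv/= => /andP.
Qed.

Lemma comonotone_law_ray1 (x : R) :
  comonotone_law (`]-oo, x]%classic `*` setT) = mu `]-oo, x]%classic.
Proof.
rewrite -distribution_functionE; apply: uniform_oo_ray => [|u u01].
  by rewrite distribution_function_ge0 distribution_function_le1.
by rewrite -quantile_patch_le//; split=> /=; rewrite !in_itv/= => // -[].
Qed.

Lemma comonotone_law_ray2 (y : R) :
  comonotone_law (setT `*` `]-oo, y]%classic) = nu `]-oo, y]%classic.
Proof.
rewrite -distribution_functionE; apply: uniform_oo_ray => [|u u01].
  by rewrite distribution_function_ge0 distribution_function_le1.
by rewrite -quantile_patch_le//; split=> /=; rewrite !in_itv/= => // -[].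
Qed.

End comonotone_law.

(** * Margins are determined by the joint distribution function *)

Section joint_distribution_functions.
Context {R : realType}.

Let rays (n : nat) : set (measurableTypeR R) := `]-oo, n%:R]%classic.

Let bigcup_rays : \bigcup_n rays n = setT.
Proof.
rewrite -subTset => x _; exists (Num.bound x) => //.
by rewrite /rays/= in_itv/= ltW// unstable.ltr_bound.
Qed.

Let sub_rays n m : (n <= m)%N -> rays n `<=` rays m.
Proof.
by move=> nm x; rewrite /rays/= !in_itv/= => /le_trans; apply; rewrite ler_nat.
Qed.

Let measurable_rays n : measurable (rays n).
Proof. exact: measurable_itv. Qed.

Variable H : R -> R -> R.
Implicit Types p q : borel_prob2 R.

(** The strip is the increasing union of the quadrants with second bound n, on which both laws are
    given by [H]; continuity from below passes to the limit. *)
Lemma joint_df_eq_ray1 p q : has_joint_df H p -> has_joint_df H q ->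
  forall x : R, p (`]-oo, x]%classic `*` setT) = q (`]-oo, x]%classic `*` setT).
Proof.
move=> Hp Hq x.
pose E n := (`]-oo, x]%classic : set (measurableTypeR R)) `*` rays n.
have EU : \bigcup_n E n = `]-oo, x]%classic `*` setT.
  by rewrite -bigcup_rays setX_bigcupr.
have mE n : measurable (E n) by apply: measurableX => //; exact: measurable_itv.
have cvgE (r : borel_prob2 R) : r (E n) @[n --> \oo] --> r (\bigcup_n E n).
  apply: nondecreasing_cvg_mu => //; first exact: bigcup_measurable.
  by move=> n m nm; apply/subsetPset; apply: setSX => //; exact: sub_rays.
rewrite -EU; apply: cvg_unique (cvgE p) _ => //.
have pqE : (fun n => p (E n)) = (fun n => q (E n)).
  by apply/funext => n; exact: etrans (Hp _ _) (esym (Hq _ _)).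
by rewrite pqE; exact: cvgE.
Qed.

Lemma joint_df_eq_ray2 p q : has_joint_df H p -> has_joint_df H q ->
  forall y : R, p (setT `*` `]-oo, y]%classic) = q (setT `*` `]-oo, y]%classic).
Proof.
move=> Hp Hq y.
pose E n := rays n `*` (`]-oo, y]%classic : set (measurableTypeR R)).
have EU : \bigcup_n E n = setT `*` `]-oo, y]%classic.
  by rewrite -bigcup_rays setX_bigcupl.
have mE n : measurable (E n) by apply: measurableX => //; exact: measurable_itv.
have cvgE (r : borel_prob2 R) : r (E n) @[n --> \oo] --> r (\bigcup_n E n).
  apply: nondecreasing_cvg_mu => //; first exact: bigcup_measurable.
  by move=> n m nm; apply/subsetPset; apply: setSX => //; exact: sub_rays.
rewrite -EU; apply: cvg_unique (cvgE p) _ => //.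
have pqE : (fun n => p (E n)) = (fun n => q (E n)).
  by apply/funext => n; exact: etrans (Hp _ _) (esym (Hq _ _)).
by rewrite pqE; exact: cvgE.
Qed.

End joint_distribution_functions.

(** * The law with distribution function min(F, G) is a coupling *)

Section joint_law_comonotone.
Context {R : realType}.
Variables mu nu : borel_prob R.
Let H := fun x y => comonotonicity_copula (distribution_function mu x)
                                          (distribution_function nu y).

(** The quantile construction provides a witness, so [get] does not return its junk value. *)
Lemma joint_law_comonotoneP : has_joint_df H (joint_law H).
Proof.
by apply: getPex; exists (comonotone_law mu nu); exact: comonotone_law_joint_df.
Qed.

Let fst_mfun :
    {mfun (measurableTypeR R * measurableTypeR R)%type >-> measurableTypeR R} :=
  mfun_Sub (mem_set measurable_fst).

Let snd_mfun :
    {mfun (measurableTypeR R * measurableTypeR R)%type >-> measurableTypeR R} :=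
  mfun_Sub (mem_set measurable_snd).

(** As a value of [get], [joint_law H] is known only through its distribution function. Its margins,
    written as images under the projections, agree on rays with those of [comonotone_law], hence
    with [mu] and [nu]. *)
Lemma joint_law_coupling : coupling mu nu (joint_law H).
Proof.
have fstE (B : set R) :
    distribution (joint_law H) fst_mfun B = joint_law H (B `*` setT).
  by congr (joint_law H _); apply/seteqP; split=> [z //|z []].
have sndE (B : set R) :
    distribution (joint_law H) snd_mfun B = joint_law H (setT `*` B).
  by congr (joint_law H _); apply/seteqP; split=> [z //|z []].
move=> A mA; split.
  rewrite -fstE; apply: borel_prob_eq_rays => // x.
  apply: etrans (fstE _) _; apply: etrans _ (comonotone_law_ray1 mu nu x).
  exact: joint_df_eq_ray1 joint_law_comonotoneP (comonotone_law_joint_df mu nu) x.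
rewrite -sndE; apply: borel_prob_eq_rays => // y.
apply: etrans (sndE _) _; apply: etrans _ (comonotone_law_ray2 mu nu y).
exact: joint_df_eq_ray2 joint_law_comonotoneP (comonotone_law_joint_df mu nu) y.
Qed.

End joint_law_comonotone.

(** * Comparison of integrals of mixtures *)

Section mixtures.
Context d d' (T : measurableType d) (U : measurableType d') (R : realType).

(** Tonelli moves the integral over u outside on both sides, where the integrands compare
    pointwise. *)
Lemma le_integral_mixture (m1 m2 : probability T R)
    (n : {sigma_finite_measure set U -> \bar R}) (D : set U)
    (f : T * U -> \bar R) :
  measurable D -> measurable_fun [set: T * U] f -> (forall z, 0 <= f z) ->
  (forall u, D u -> \int[m1]_x f (x, u) <= \int[m2]_x f (x, u)) ->
  \int[m1]_x \int[n]_(u in D) f (x, u) <= \int[m2]_x \int[n]_(u in D) f (x, u).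
Proof.
move=> mD mf f0 m12.
(* Extension by 0 off [D] lets Tonelli run over the full product; for u outside [D] both inner
   integrals vanish. *)
pose g := f \_ (setT `*` D).
have mTD : measurable ([set: T] `*` D) by exact: measurableX.
have mg : measurable_fun setT g.
  by apply/(measurable_restrictT _ mTD); exact: measurable_funTS.
have g0 z : 0 <= g z by rewrite /g; apply: erestrict_ge0.
have gE x : \int[n]_(u in D) f (x, u) = \int[n]_u g (x, u).
  rewrite integral_mkcond; apply: eq_integral => u _.
  by rewrite /g !patchE; congr (if _ then _ else _); rewrite in_setX in_setT.
under eq_integral do rewrite gE.
under [leRHS]eq_integral do rewrite gE.
rewrite (fubini_tonelli g)// (fubini_tonelli g)//.
apply: ge0_le_integral => //.
- by move=> u _; exact: integral_ge0.
- exact: measurable_fun_fubini_tonelli_G.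
- exact: measurable_fun_fubini_tonelli_G.
move=> u _; have [uD|uD] := boolP (u \in D).
  have gf x : g (x, u) = f (x, u) by rewrite /g patchE in_setX in_setT uD.
  under eq_integral do rewrite gf.
  under [leRHS]eq_integral do rewrite gf.
  by apply: m12; rewrite inE in uD.
have gf x : g (x, u) = 0 by rewrite /g patchE in_setX in_setT (negbTE uD).
by rewrite integral0_eq ?integral_ge0.
Qed.

End mixtures.

(** * Concordance order and truncated distance costs *)

Section concordance_order.
Context {R : realType}.
Variables (mu nu : borel_prob R) (p q : borel_prob2 R).
Hypotheses (cp : coupling mu nu p) (cq : coupling mu nu q).
(** This is the concordance order between laws with common margins, [p] being the more concordant
    one. *)
Hypothesis pq : forall x y : R,
  q (`]-oo, x]%classic `*` `]-oo, y]%classic) <=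
  p (`]-oo, x]%classic `*` `]-oo, y]%classic).

(** The tail set is a strip minus a quadrant. The margin fixes the mass of the strip, so more mass
    on the quadrant means less on the tail. *)
Lemma concordance_tail1 (s t : R) :
  p (`]-oo, s]%classic `*` `]t, +oo[%classic) <=
  q (`]-oo, s]%classic `*` `]t, +oo[%classic).
Proof.
have tailE (r : borel_prob2 R) : coupling mu nu r ->
    r (`]-oo, s]%classic `*` `]t, +oo[%classic) =
    mu `]-oo, s]%classic - r (`]-oo, s]%classic `*` `]-oo, t]%classic).
  move=> cr; rewrite -(cr _ (measurable_itv _)).1.
  rewrite (_ : _ `*` `]t, +oo[ = (`]-oo, s] `*` setT) `\` (setT `*` `]-oo, t])).
    rewrite measureD; last 3 first.
    - by apply: measurableX => //; exact: measurable_itv.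
    - by apply: measurableX => //; exact: measurable_itv.
    - rewrite (le_lt_trans (probability_le1 _ _)) ?ltry//.
      by apply: measurableX => //; exact: measurable_itv.
    by congr (_ - r _); apply/seteqP; split=> [z [[? _] [_ ?]]|z [? ?]].
  apply/seteqP; split=> [[x y]|[x y]] /=; rewrite !in_itv/= !andbT.
    by move=> [xs ty]; split=> // -[_]; rewrite leNgt ty.
  move=> [[xs _] yt]; split=> //; rewrite ltNge; apply/negP => yt'.
  exact: yt.
by rewrite !tailE//; apply: leeB.
Qed.

Lemma concordance_tail2 (s t : R) :
  p (`]t, +oo[%classic `*` `]-oo, s]%classic) <=
  q (`]t, +oo[%classic `*` `]-oo, s]%classic).
Proof.
have tailE (r : borel_prob2 R) : coupling mu nu r ->
    r (`]t, +oo[%classic `*` `]-oo, s]%classic) =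
    nu `]-oo, s]%classic - r (`]-oo, t]%classic `*` `]-oo, s]%classic).
  move=> cr; rewrite -(cr _ (measurable_itv _)).2.
  rewrite (_ : `]t, +oo[ `*` _ = (setT `*` `]-oo, s]) `\` (`]-oo, t] `*` setT)).
    rewrite measureD; last 3 first.
    - by apply: measurableX => //; exact: measurable_itv.
    - by apply: measurableX => //; exact: measurable_itv.
    - rewrite (le_lt_trans (probability_le1 _ _)) ?ltry//.
      by apply: measurableX => //; exact: measurable_itv.
    by congr (_ - r _); apply/seteqP; split=> [z [[_ ?] [? _]]|z [? ?]].
  apply/seteqP; split=> [[x y]|[x y]] /=; rewrite !in_itv/= !andbT.
    by move=> [tx ys]; split=> // -[]; rewrite leNgt tx.
  move=> [[_ ys] xt]; split=> //; rewrite ltNge; apply/negP => xt'.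
  exact: xt.
by rewrite !tailE//; apply: leeB.
Qed.

Let Rm := measurableTypeR R.

(* [crossing k (x, y) s] tells whether [s, s + k] separates x and y; its
   integral over s is the length by which |x - y| exceeds k. *)
Let crossing (k : R) (z : Rm * Rm) (s : R) : R :=
  (\1_(`]-oo, s]%classic `*` `](s + k)%R, +oo[%classic) z +
   \1_(`](s + k)%R, +oo[%classic `*` `]-oo, s]%classic) z)%R.

Let measurable_crossing (k : R) :
  measurable_fun [set: (Rm * Rm) * Rm] (fun w => (crossing k w.1 w.2)%:E).
Proof.
have m1 : measurable_fun [set: (Rm * Rm) * Rm] (fun w => w.1.1 : R).
  exact: measurableT_comp measurable_fst measurable_fst.
have m2 : measurable_fun [set: (Rm * Rm) * Rm] (fun w => w.1.2 : R).
  exact: measurableT_comp measurable_snd measurable_fst.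
have m3 : measurable_fun [set: (Rm * Rm) * Rm] (fun w => w.2 : R).
  exact: measurable_snd.
have m3k : measurable_fun [set: (Rm * Rm) * Rm] (fun w => (w.2 : R) + k)%R.
  by apply: measurable_funD.
have mb (b : (Rm * Rm) * Rm -> bool) : measurable_fun setT b ->
    measurable_fun setT (fun w => (b w)%:R : R).
  move=> mb; rewrite (_ : (fun w => _) = \1_[set w | b w]).
    apply: measurable_indic; rewrite -[X in measurable X]setTI.
    exact: (mb measurableT [set true]).
  by apply/funext => w; rewrite indicE; congr (nat_of_bool _)%:R; apply/esym/asboolb.
apply/measurable_EFinP.
(* The sets under the indicators move with s, so joint measurability is obtained from comparisons
   between the coordinates of w. *)
rewrite (_ : (fun w => _) = (fun w : (Rm * Rm) * Rm =>
  ((((w.1.1 : R) <= w.2) && ((w.2 : R) + k < w.1.2))%:R +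
   (((w.2 : R) + k < w.1.1) && ((w.1.2 : R) <= w.2))%:R)%R)).
  apply: measurable_funD; apply: mb; apply: measurable_and.
  - exact: measurable_fun_ler.
  - exact: measurable_fun_ltr.
  - exact: measurable_fun_ltr.
  - exact: measurable_fun_ler.
apply/funext => w; rewrite /crossing !indicE !in_setX !mem_setE !in_itv/=.
by rewrite !andbT.
Qed.

(** For fixed (x, y), the two terms are, as functions of s, the indicators of [x, y - k[ and [y, x -
    k[; since k >= 0, at most one of these is nonempty. *)
Let integral_crossing (k : R) (z : Rm * Rm) : (0 <= k)%R ->
  \int[lebesgue_measure]_s (crossing k z s)%:E =
  (Num.max 0 (`|(z.1 : R) - z.2| - k))%:E%R.
Proof.
case: z => x y k0; rewrite /crossing.
have E1 s : (\1_(`]-oo, s]%classic `*` `](s + k)%R, +oo[%classic) (x, y) : R) =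
    \1_(`[x, (y - k)%R[%classic) s.
  rewrite !indicE in_setX !mem_setE !in_itv/= andbT; congr (nat_of_bool _)%:R.
  by rewrite ltrBrDr.
have E2 s : (\1_(`](s + k)%R, +oo[%classic `*` `]-oo, s]%classic) (x, y) : R) =
    \1_(`[y, (x - k)%R[%classic) s.
  rewrite !indicE in_setX !mem_setE !in_itv/= andbT andbC.
  by rewrite ltrBrDr.
under eq_integral do rewrite E1 E2 EFinD.
rewrite ge0_integralD//=; last 2 first.
- by apply/measurable_EFinP; exact: measurable_indic.
- by apply/measurable_EFinP; exact: measurable_indic.
rewrite !integral_indic// !setIT.
have itvE (u v : R) :
    lebesgue_measure (`[u, v[%classic : set R) = (Num.max 0 (v - u))%:E%R.
  rewrite lebesgue_measure_itv/= lte_fin -EFinB.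
  by case: ltP => uv; congr EFin; [rewrite max_r|rewrite max_l]; lra.
apply: etrans (congr2 (fun a b => a + b) (itvE x (y - k)%R) (itvE y (x - k)%R)) _.
rewrite /= -EFinD; congr EFin; move: (x : R) (y : R) => {E1 E2 x y} x y.
by case: (lerP x y) => xy; do 3?[case: (leP 0%R _) => ?]; lra.
Qed.

(** Once the cost is an integral over s of crossings, its expectation at fixed s is the sum of two
    tail masses, each of which is smaller under [p]. *)
Lemma concordance_le_truncated_cost (k : R) : (0 <= k)%R ->
  \int[p]_z (Num.max 0 (`|(z.1 : R) - (z.2 : R)| - k))%:E%R <=
  \int[q]_z (Num.max 0 (`|(z.1 : R) - (z.2 : R)| - k))%:E%R.
Proof.
move=> k0.
under eq_integral do rewrite -integral_crossing//.
under [leRHS]eq_integral do rewrite -integral_crossing//.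
apply: (@le_integral_mixture _ _ (Rm * Rm)%type Rm R p q lebesgue_measure setT
  (fun w => (crossing k w.1 w.2)%:E)) => //.
  by move=> z; rewrite lee_fin addr_ge0.
move=> s _; rewrite /crossing/=.
have crossingE (r : borel_prob2 R) :
    \int[r]_z (\1_(`]-oo, s]%classic `*` `](s + k)%R, +oo[%classic) z +
      \1_(`](s + k)%R, +oo[%classic `*` `]-oo, s]%classic) z)%:E%R =
    r (`]-oo, s]%classic `*` `](s + k)%R, +oo[%classic) +
    r (`](s + k)%R, +oo[%classic `*` `]-oo, s]%classic).
  under eq_integral do rewrite EFinD.
  have mX (I J : interval R) : measurable ([set` I] `*` [set` J] : set (Rm * Rm)).
    by apply: measurableX; exact: measurable_itv.
  rewrite ge0_integralD//=; last 2 first.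
  - by apply/measurable_EFinP; exact: measurable_indic.
  - by apply/measurable_EFinP; exact: measurable_indic.
  by rewrite !integral_indic// !setIT.
rewrite !crossingE; apply: leeD; first exact: concordance_tail1.
exact: concordance_tail2.
Qed.

End concordance_order.

(** * Powers as mixtures of truncations *)

Section power_decomposition.
Context {R : realType}.
Implicit Types a d p r : R.

(** Away from 0 continuity follows from differentiability; this may fail at 0 when a < 1, so the
    right limit there is treated separately. *)
Lemma within_continuous_powR a (T : R) : (0 < a)%R -> (0 < T)%R ->
  {within `[0%R, T], continuous (fun r => r `^ a)%R}.
Proof.
move=> a0 T0.
have cts x : (0 < x)%R -> {for x, continuous (fun r : R => r `^ a)%R}.
  move=> x0; apply/differentiable_continuous/derivable1_diffP.
  by apply: derivable_powR; rewrite in_itv/= x0.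
apply/(continuous_within_itvP _ T0); split.
- by move=> x; rewrite in_itv/= => /andP[x0 _]; exact: cts.
- by rewrite powR0 ?gt_eqF//; exact: powR_cvg0.
- exact/cvg_at_left_filter/cts.
Qed.

(* The substitution r = t^(p-1) turns d^p = int_0^d p (p - 1) t^(p-2) (d - t) dt
   into an integral without singularity at 0. *)
Lemma powR_integral p d : (1 < p)%R -> (0 <= d)%R ->
  (d `^ p)%:E%R = \int[lebesgue_measure]_(r in `[0%R, +oo[)
                    (p * Num.max 0 (d - r `^ (p - 1)^-1))%:E%R.
Proof.
move=> p1; rewrite le_eqVlt => /predU1P[<-|d0].
  (* For d = 0 the interval [0, T] used below would degenerate, but the integrand is then
     identically 0. *)
  rewrite powR0; last by rewrite gt_eqF//; lra.
  rewrite integral0_eq// => r _.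
  by rewrite sub0r max_l ?mulr0// oppr_le0 powR_ge0.
(* [T] is the point where r^a reaches d; beyond it the truncated integrand vanishes. *)
set a := (p - 1)^-1%R; pose T : R := (d `^ (p - 1))%R.
have a0 : (0 < a)%R by rewrite invr_gt0; lra.
have T0 : (0 < T)%R by rewrite powR_gt0.
have [a_ge0 T_ge0] := (ltW a0, ltW T0).
have Ta : (T `^ a)%R = d by rewrite -powRrM mulfV ?powRr1 ?ltW// gt_eqF//; lra.
have -> : \int[lebesgue_measure]_(r in `[0%R, +oo[) (p * Num.max 0 (d - r `^ a))%:E%R =
    \int[lebesgue_measure]_(r in `[0%R, T]) (p * (d - r `^ a))%:E%R.
  rewrite (_ : `[0%R, T] = `[0%R, +oo[ `&` `[0%R, T])%classic; last first.
    by apply/seteqP; split=> [r|r []//] /=; rewrite !in_itv/= andbT => /[dup] ? /andP[].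
  rewrite integral_mkcondr; apply: eq_integral => r; rewrite inE/= in_itv/= andbT => r0.
  rewrite patchE mem_setE in_itv/= r0/=; case: leP => rT.
    congr (_ * _)%:E%R; rewrite max_r// subr_ge0 -[leRHS]Ta.
    by apply: ge0_ler_powR; rewrite ?nnegrE// ltW.
  congr EFin; rewrite max_l ?mulr0// subr_le0 -[leLHS]Ta.
  by apply: ge0_ler_powR; rewrite ?nnegrE// ltW.
(* Since (p - 1)(a + 1) = p, the derivative of [F] is p (d - r^a). *)
pose F (r : R) : R := (p * d * r - (p - 1) * r `^ (a + 1))%R.
have dF (x : R) : (0 < x)%R -> is_derive x 1%R F (p * (d - x `^ a))%R.
  move=> x0.
  have := is_derive1_powR (a + 1)%R x0; rewrite addrK => dpow.
  rewrite /F.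
  apply: is_derive_eq.
  rewrite /GRing.scale/= mulr1.
  have -> : ((p - 1) * ((a + 1) * x `^ a) = p * x `^ a)%R.
    rewrite mulrA; congr (_ * _)%R; rewrite mulrDr mulfV ?mulr1; last first.
      by rewrite gt_eqF//; lra.
    lra.
  lra.
have cF : {within `[0%R, T], continuous F}.
  move=> x; apply: cvgB; first by
    apply: (continuous_subspaceT (f := fun r : R => (p * d * r)%R));
    exact: mulrl_continuous.
  by apply: cvgM; [exact: cvg_cst|apply: within_continuous_powR => //; lra].
rewrite (continuous_FTC2 T0 (F := F)).
(* F(0) = 0, and T^(a + 1) = d T gives F(T) = p d T - (p - 1) d T = d T = d^p. *)
- rewrite /F mulr0 powR0 ?gt_eqF//; last lra.
  rewrite mulr0 subrr sube0; congr EFin.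
  rewrite powRD ?Ta; last by rewrite (gt_eqF T0) implybT.
  rewrite powRr1 ?ltW// /T [(d * _)%R]mulr_powRB1 ?ltW//; last lra.
  rewrite -mulrA [(d * _)%R]mulr_powRB1 ?ltW//; last lra.
  lra.
- move=> x; apply: cvgM; first exact: cvg_cst.
  by apply: cvgB; [exact: cvg_cst|exact: within_continuous_powR].
- split.
  + by move=> x; rewrite in_itv/= => /andP[/dF []].
  + by have /(continuous_within_itvP _ T0)[] := cF.
  + by have /(continuous_within_itvP _ T0)[] := cF.
- move=> x; rewrite in_itv/= => /andP[/dF dFx _].
  by rewrite derive1E; exact: derive_val.
Qed.

End power_decomposition.

(** * Power costs and the upper bound on couplings *)

Section concordance_power_cost.
Context {R : realType}.

Lemma concordance_le_power_cost (e : R) (mu nu : borel_prob R)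
    (p q : borel_prob2 R) :
  (1 <= e)%R -> coupling mu nu p -> coupling mu nu q ->
  (forall x y : R, q (`]-oo, x]%classic `*` `]-oo, y]%classic) <=
                   p (`]-oo, x]%classic `*` `]-oo, y]%classic)) ->
  \int[p]_z ((`|(z.1 : R) - (z.2 : R)| `^ e)%R)%:E <=
  \int[q]_z ((`|(z.1 : R) - (z.2 : R)| `^ e)%R)%:E.
Proof.
move=> e1 cp cq pq; have trunc := concordance_le_truncated_cost cp cq pq.
move: e1; rewrite le_eqVlt => /predU1P[<-|e1].
  (* The exponent 1 is not covered by [powR_integral]; its cost is the truncated distance with k =
     0. *)
  have costE (z : measurableTypeR R * measurableTypeR R) :
      ((`|(z.1 : R) - (z.2 : R)| `^ 1)%R)%:E =
      (Num.max 0 (`|(z.1 : R) - (z.2 : R)| - 0))%:E%R.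
    by rewrite powRr1// subr0 max_r.
  under eq_integral do rewrite costE.
  by under [leRHS]eq_integral do rewrite costE; exact: trunc.
under eq_integral do rewrite (powR_integral e1)//.
under [leRHS]eq_integral do rewrite (powR_integral e1)//.
pose a := (e - 1)^-1%R.
pose Rm := measurableTypeR R.
have mdist : measurable_fun [set: (Rm * Rm) * Rm]
    (fun w => `|(w.1.1 : R) - (w.1.2 : R)|%R).
  apply: measurableT_comp => //; apply: measurable_funB.
    exact: measurableT_comp measurable_fst measurable_fst.
  exact: measurableT_comp measurable_snd measurable_fst.
apply: (@le_integral_mixture _ _ (Rm * Rm)%type Rm R p q lebesgue_measure
  `[0%R, +oo[%classic
  (fun w => (e * Num.max 0 (`|(w.1.1 : R) - w.1.2| - (w.2 : R) `^ a))%:E%R)).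
- exact: measurable_itv.
- apply/measurable_EFinP; apply: measurable_funM => //.
  apply: measurable_maxr => //; apply: measurable_funB => //.
  exact: measurableT_comp (measurable_powR a) measurable_snd.
- by move=> w; rewrite lee_fin mulr_ge0 ?le_max ?lexx//; lra.
move=> r _ /=.
(* At fixed r the integrand is e times the distance truncated at k = r^a >= 0. *)
have scaleE (s : borel_prob2 R) :
    \int[s]_z (e * Num.max 0 (`|(z.1 : R) - z.2| - (r : R) `^ a))%:E%R =
    e%:E * \int[s]_z (Num.max 0 (`|(z.1 : R) - z.2| - (r : R) `^ a))%:E%R.
  under eq_integral do rewrite EFinM.
  rewrite ge0_integralZl_EFin//; last lra.
  apply/measurable_EFinP; apply: measurable_maxr => //.
  apply: measurable_funB => //; apply: measurableT_comp => //.
  by apply: measurable_funB; [exact: measurable_fst|exact: measurable_snd].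
rewrite !scaleE; apply: lee_wpmul2l; first by rewrite lee_fin; lra.
by apply: trunc; exact: powR_ge0.
Qed.

(** This is the Fréchet-Hoeffding upper bound: the quadrant lies in two strips whose masses are
    fixed by the margins. *)
Lemma coupling_le_comonotone (mu nu : borel_prob R) (p : borel_prob2 R)
    (x y : R) : coupling mu nu p ->
  p (`]-oo, x]%classic `*` `]-oo, y]%classic) <=
  (comonotonicity_copula (distribution_function mu x)
                         (distribution_function nu y))%:E.
Proof.
move=> cp; rewrite /comonotonicity_copula EFin_min !distribution_functionE le_min.
have [mx my] : measurable (`]-oo, x]%classic : set (measurableTypeR R)) /\
    measurable (`]-oo, y]%classic : set (measurableTypeR R)).
  by split; exact: measurable_itv.
rewrite -(cp _ mx).1 -(cp _ my).2; apply/andP; split; apply: le_measure;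
  rewrite ?inE; try exact: measurableX.
- by move=> z [].
- by move=> z [].
Qed.

End concordance_power_cost.

Theorem theorem3p1 (R : realType) (p : R) (hp : (1 <= p)%R)
    (mu nu : borel_prob R)
    (hmu : finite_moment p mu) (hnu : finite_moment p nu) :
  let F := distribution_function mu in
  let G := distribution_function nu in
  wasserstein p mu nu `^ p =
  \int[joint_law (fun x y => comonotonicity_copula (F x) (G y))]_z
    ((`|(z.1 : R) - (z.2 : R)| `^ p)%R)%:E.
Proof.
(* The exponents 1/p and p cancel because p is nonzero and the infimum is nonnegative. *)
move=> F G; rewrite /wasserstein -poweRrM mulVf ?poweRe1; last first.
- by rewrite gt_eqF//; lra.
- apply: le_ereal_inf_tmp => _ [q _ <-]; apply: integral_ge0 => z _.
  by rewrite lee_fin powR_ge0.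
have cJ := joint_law_coupling mu nu.
(* The comonotone law is itself admissible in the infimum, which gives one inequality; the other
   says that no coupling costs less. *)
apply/eqP; rewrite eq_le; apply/andP; split.
  apply: ge_ereal_inf; eexists; last exact: lexx.
  by exists (joint_law (fun x y => comonotonicity_copula (F x) (G y))).
apply: le_ereal_inf_tmp => _ [q cq <-].
apply: (concordance_le_power_cost hp cJ cq) => x y.
rewrite joint_law_comonotoneP; exact: coupling_le_comonotone.
Qed.
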